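(* Let $n \geq 2$ and let $A=[a_{ij}]\in \mathbb{C}^{n,n}$ be a Nekrasov matrix, i.e. $|a_{ii}|>h_i(A)$ for every $i\in N=\{1,2,\ldots,n\}$. Define $$z_1(A) := 1, \qquad z_i(A) := \sum_{j=1}^{i-1} \frac{|a_{ij}|}{|a_{jj}|}\, z_j(A) + 1, \quad i \in N\setminus\{1\}.$$ Then $$\| A^{-1} \|_{\infty} \leq \frac{\displaystyle\max_{i \in N} \frac{z_i(A)}{|a_{ii}|}}{1 - \displaystyle\max_{i\in N} \frac{h_i(A)}{|a_{ii}|}}$$ and $$\|A^{-1}\|_\infty\leq \frac{\displaystyle\max_{i\in N}z_i(A)}{\displaystyle\min_{i\in N}\left(|a_{ii}|-h_i(A)\right)}.$$
   Context: $\mathbb{C}^{n,n}$ denotes the set of all $n\times n$ complex matrices and $N:=\{1,2,\ldots,n\}$. For $A=[a_{ij}]\in\mathbb{C}^{n,n}$ the quantities $h_i(A)$ are defined recursively by $$h_1(A) := \sum_{j\neq 1}|a_{1j}|, \qquad h_i(A) := \sum_{j=1}^{i-1}|a_{ij}|\frac{h_j(A)}{|a_{jj}|} + \sum_{j=i+1}^{n}|a_{ij}|, \quad i = 2,\ldots,n.$$ A matrix $A=[a_{ij}]\in\mathbb{C}^{n,n}$, $n\geq 2$, is called a Nekrasov matrix if $|a_{ii}|>h_i(A)$ for each $i\in N$ (in particular all its diagonal entries are nonzero). It is known that every Nekrasov matrix is a nonsingular $H$-matrix, so $A^{-1}$ exists. $\|\cdot\|_\infty$ is the matrix norm induced by the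 maximum vector norm, i.e. $\|M\|_\infty=\max_{i}\sum_{j}|m_{ij}|$. *)

(* Defs.v *)
From HB Require Import structures.
From mathcomp Require Import all_boot all_order all_algebra.
From mathcomp Require Import reals.
From mathcomp Require Export complex.

Set Implicit Arguments.
Unset Strict Implicit.
Unset Printing Implicit Defensive.

Import Order.TTheory GRing.Theory Num.Theory.
Local Open Scope ring_scope.

(* The index set {1, ..., n} is represented by 'I_n = {0, ..., n-1}.
   The modulus is the real-valued [normc : R[i] -> R], rather than the norm
   `|z| : R[i], so that all the quantities below live in the ordered field R. *)
Notation normc := ComplexField.Normc.normc.

Section FiniteMaxMin.
Variables (R : realType) (n : nat).
Implicit Types f : 'I_n -> R.

(* Starting from a value of f makes these the true maximum and minimum, whatever
   the signs of the values, as soon as 0 < n; they are 0 when n = 0. *)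
Definition maxN f : R := \big[Num.max/head 0 (codom f)]_(i < n) f i.
Definition minN f : R := \big[Num.min/head 0 (codom f)]_(i < n) f i.

Lemma head_codom f : (0 < n)%N -> exists i, head 0 (codom f) = f i.
Proof.
move=> n0; have : head 0 (codom f) \in codom f.
  have : size (codom f) = n by rewrite size_codom card_ord.
  by case: (codom f) => [|x s] /= sz; [rewrite -sz in n0 | rewrite mem_head].
by move/codomP.
Qed.

Lemma maxN_ge f i : f i <= maxN f.
Proof. exact: le_bigmax. Qed.

Lemma maxN_attained f : (0 < n)%N -> exists i, maxN f = f i.
Proof.
move=> n0; rewrite /maxN.
elim/big_rec: _ => [|i x _ [j ->]]; first exact: head_codom.
by case: (leP (f i) (f j)) => _; [exists j | exists i].
Qed.

Lemma minN_le f i : minN f <= f i.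
Proof. exact: bigmin_le. Qed.

Lemma minN_attained f : (0 < n)%N -> exists i, minN f = f i.
Proof.
move=> n0; rewrite /minN.
elim/big_rec: _ => [|i x _ [j ->]]; first exact: head_codom.
by case: (leP (f i) (f j)) => _; [exists i | exists j].
Qed.

End FiniteMaxMin.

Section OrdinalRecursion.
Variables (R : realType) (n : nat).
Implicit Type F : 'I_n -> ('I_n -> R) -> R.

Fixpoint ord_rec_fuel F (k : nat) (i : 'I_n) : R :=
  if k is k'.+1 then F i (ord_rec_fuel F k') else 0.

(* The family x with x i = F i x, where F i only uses the values x j, j < i;
   i.+1 steps of fuel suffice to compute x i, see ord_recE. *)
Definition ord_rec F (i : 'I_n) : R := ord_rec_fuel F i.+1 i.

Lemma ord_recE F :
  (forall (i : 'I_n) (x y : 'I_n -> R), (forall j : 'I_n, (j < i)%N -> x j = y j) -> F i x = F i y) ->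
  forall i, ord_rec F i = F i (ord_rec F).
Proof.
move=> loc.
have fuelE k l (i : 'I_n) : (i < k)%N -> (i < l)%N ->
    ord_rec_fuel F k i = ord_rec_fuel F l i.
  elim: k l i => [|k IH] [|l] i ik il //=.
  by apply: loc => j ji; apply: IH; apply: leq_trans ji _.
move=> i; rewrite {1}/ord_rec /=; apply: loc => j ji.
by apply: fuelE.
Qed.

End OrdinalRecursion.

Section Nekrasov.
Variables (R : realType) (n : nat).
Implicit Type A : 'M[R[i]]_n.

Definition nek_h A : 'I_n -> R := ord_rec (fun i h =>
  \sum_(j < n | (j < i)%N) normc (A i j) * (h j / normc (A j j))
  + \sum_(j < n | (i < j)%N) normc (A i j)).

Definition nek_z A : 'I_n -> R := ord_rec (fun i z =>
  \sum_(j < n | (j < i)%N) normc (A i j) / normc (A j j) * z j + 1).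

Lemma nek_hE A i : nek_h A i =
  \sum_(j < n | (j < i)%N) normc (A i j) * (nek_h A j / normc (A j j))
  + \sum_(j < n | (i < j)%N) normc (A i j).
Proof.
rewrite {1}/nek_h ord_recE // => k x y xy; congr (_ + _).
by apply: eq_bigr => j jk; rewrite xy.
Qed.

Lemma nek_zE A i : nek_z A i =
  \sum_(j < n | (j < i)%N) normc (A i j) / normc (A j j) * nek_z A j + 1.
Proof.
rewrite {1}/nek_z ord_recE // => k x y xy; congr (_ + _).
by apply: eq_bigr => j jk; rewrite xy.
Qed.

Definition nekrasov A : Prop := forall i, nek_h A i < normc (A i i).

Definition norm_inf A : R := maxN (fun i => \sum_(j < n) normc (A i j)).

End Nekrasov.

(* Main.v *)
Require Import Defs.
From mathcomp Require Import all_boot all_order all_algebra.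
From mathcomp Require Import reals ring.

Set Implicit Arguments.
Unset Strict Implicit.
Unset Printing Implicit Defensive.

Import Order.TTheory GRing.Theory Num.Theory.
Local Open Scope ring_scope.

(** The bound comes from a forward substitution carried out on absolute row
    sums.  Let [r i] be the sum of the moduli of row [i] of a matrix [B], let
    [X] be the largest of these sums, and let [M] bound the absolute row sums
    of [A *m B].  Isolating the diagonal term in row [i] of [A *m B] gives
      |a_ii| r_i <= sum_(j < i) |a_ij| r_j + sum_(j > i) |a_ij| r_j + M.
    In the second sum [r j] is bounded by [X]; in the first one it is bounded,
    by strong induction, by [(h_j X + z_j M) / |a_jj|].  The coefficients of
    [X] and [M] that result are exactly the recursions defining [h_i] and
    [z_i], so
      |a_ii| r_i <= h_i X + z_i M           ([nekrasov_forward_bound]).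
    At a row where [r i = X] this reads [X (|a_ii| - h_i) <= z_i M]
    ([nekrasov_max_row_sum]), with a positive factor on the left.

    Taking for [B] a kernel vector of [A], with [M = 0], forces [B = 0], so [A]
    is invertible.  Taking [B = invmx A], with [M = 1], gives
    [norm_inf (invmx A) <= z_i / (|a_ii| - h_i)] for a single index [i]; both
    stated bounds dominate this quotient, the first one after dividing its
    numerator and denominator by [|a_ii|]. *)

Lemma normc_ge0 (R : realType) (x : R[i]) : 0 <= normc x.
Proof. by case: x => a b; exact: sqrtr_ge0. Qed.

Lemma normc_sum_le (R : realType) (I : Type) (s : seq I) (P : pred I)
    (F : I -> R[i]) :
  normc (\sum_(k <- s | P k) F k) <= \sum_(k <- s | P k) normc (F k).
Proof.
elim/big_rec2: _ => [|k y x _ le_xy]; first by rewrite ComplexField.Normc.normc0.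
by apply: le_trans (le_normcD _ _) _; rewrite lerD2l.
Qed.

Definition abs_row_sum (R : realType) (n p : nat) (B : 'M[R[i]]_(n, p))
  (k : 'I_n) : R := \sum_(j < p) normc (B k j).

(** The triangle inequality for the diagonal term of row [k] of [A *m B], summed
    over the columns.  Working with whole row sums rather than with one vector
    means that no phases have to be chosen to realize the norm of [B]. *)
Lemma abs_row_sum_diag_le (R : realType) (n p : nat) (A : 'M[R[i]]_n)
    (B : 'M[R[i]]_(n, p)) (k : 'I_n) :
  normc (A k k) * abs_row_sum B k <=
    \sum_(j < n | j != k) normc (A k j) * abs_row_sum B j
    + abs_row_sum (A *m B) k.
Proof.
rewrite /abs_row_sum mulr_sumr.
under [X in _ <= X + _]eq_bigr => j _ do rewrite mulr_sumr.
rewrite exchange_big -big_split /=; apply: ler_sum => c _.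
have diagE : A k k * B k c
    = \sum_(j < n | j != k) - (A k j * B j c) + (A *m B) k c.
  by rewrite mxE [X in _ = _ + X](bigD1 k) // /= sumrN addrCA addNr addr0.
rewrite -ComplexField.Normc.normcM diagE.
apply: le_trans (le_normcD _ _) _; rewrite lerD2r.
apply: le_trans (normc_sum_le _ _ _) _; apply: ler_sum => j _.
by rewrite normcN ComplexField.Normc.normcM.
Qed.

Lemma sum_neq_ord (R : realType) (n : nat) (k : 'I_n) (F : 'I_n -> R) :
  \sum_(j < n | j != k) F j
    = \sum_(j < n | (j < k)%N) F j + \sum_(j < n | (k < j)%N) F j.
Proof.
rewrite (bigID (fun j : 'I_n => (j < k)%N)) /=.
congr (_ + _); apply: eq_bigl => j; rewrite -val_eqE /=; by case: ltngtP.
Qed.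

Lemma nek_h_ge0 (R : realType) (n : nat) (A : 'M[R[i]]_n) (k : 'I_n) :
  0 <= nek_h A k.
Proof.
have [m] := ubnP (val k); elim: m k => // m IH k /ltnSE le_km.
rewrite nek_hE addr_ge0 ?sumr_ge0 // => j lt_jk; last exact: normc_ge0.
by rewrite mulr_ge0 ?divr_ge0 ?normc_ge0 // IH // (leq_trans lt_jk).
Qed.

Lemma nek_z_ge0 (R : realType) (n : nat) (A : 'M[R[i]]_n) (k : 'I_n) :
  0 <= nek_z A k.
Proof.
have [m] := ubnP (val k); elim: m k => // m IH k /ltnSE le_km.
rewrite nek_zE addr_ge0 ?sumr_ge0 // => j lt_jk.
by rewrite mulr_ge0 ?divr_ge0 ?normc_ge0 // IH // (leq_trans lt_jk).
Qed.

Lemma nekrasov_diag_gt0 (R : realType) (n : nat) (A : 'M[R[i]]_n) (k : 'I_n) :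
  nekrasov A -> 0 < normc (A k k).
Proof. by move=> hA; apply: le_lt_trans (nek_h_ge0 A k) (hA k). Qed.

(** Forward substitution in the system of inequalities satisfied by [r]: the
    recursions defining [nek_h] and [nek_z] propagate the coefficients of [X]
    and of [M] respectively. *)
Lemma nekrasov_forward_bound (R : realType) (n : nat) (A : 'M[R[i]]_n)
    (r : 'I_n -> R) (X M : R) :
  nekrasov A -> (forall k, r k <= X) ->
  (forall k, normc (A k k) * r k <=
     \sum_(j < n | j != k) normc (A k j) * r j + M) ->
  forall k, normc (A k k) * r k <= nek_h A k * X + nek_z A k * M.
Proof.
move=> hA rX rA k.
have [m] := ubnP (val k); elim: m k => // m IH k /ltnSE le_km.
apply: le_trans (rA k) _.
rewrite sum_neq_ord nek_hE nek_zE !mulrDl mul1r !mulr_suml.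
rewrite -[leLHS]addrA [leRHS]addrACA -big_split /=.
apply: lerD; last first.
  by rewrite lerD2r; apply: ler_sum => j _; rewrite ler_wpM2l ?normc_ge0.
apply: ler_sum => j lt_jk.
have aj_gt0 := nekrasov_diag_gt0 j hA.
have -> : normc (A k j) * (nek_h A j / normc (A j j)) * X
    + normc (A k j) / normc (A j j) * nek_z A j * M
  = normc (A k j) * ((nek_h A j * X + nek_z A j * M) / normc (A j j)).
  by ring.
rewrite ler_wpM2l ?normc_ge0 // ler_pdivlMr // mulrC.
by apply: IH; apply: leq_trans lt_jk le_km.
Qed.

(** The index in the conclusion is a row where [abs_row_sum B] is maximal: there
    the forward bound has the maximum on both sides. *)
Lemma nekrasov_max_row_sum (R : realType) (n p : nat) (A : 'M[R[i]]_n)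
    (B : 'M[R[i]]_(n, p)) (M : R) :
  (0 < n)%N -> nekrasov A -> (forall k, abs_row_sum (A *m B) k <= M) ->
  exists k, maxN (abs_row_sum B) * (normc (A k k) - nek_h A k) <= nek_z A k * M.
Proof.
move=> n_gt0 hA ABM; have [k maxE] := maxN_attained (abs_row_sum B) n_gt0.
exists k; rewrite mulrBr lerBlDl {1}maxE [leLHS]mulrC [maxN _ * _]mulrC.
apply: nekrasov_forward_bound => // [j|j]; first exact: maxN_ge.
by apply: le_trans (abs_row_sum_diag_le A B j) _; rewrite lerD2l.
Qed.

Lemma nekrasov_unitmx (R : realType) (n : nat) (A : 'M[R[i]]_n) :
  (0 < n)%N -> nekrasov A -> A \in unitmx.
Proof.
move=> n_gt0 hA; rewrite unitmxE unitfE -det_tr; apply/negP => /det0P [v v_neq0 vA0].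
have Av0 : A *m v^T = 0 by rewrite -[A]trmxK -trmx_mul vA0 trmx0.
have [|k] := nekrasov_max_row_sum (B := v^T) (M := 0) n_gt0 hA.
  move=> k; rewrite Av0 /abs_row_sum big1 // => j _.
  by rewrite mxE ComplexField.Normc.normc0.
rewrite mulr0 pmulr_lle0 ?subr_gt0 // => max_le0.
case/eqP: v_neq0; apply/rowP => j; rewrite mxE.
apply: ComplexField.Normc.eq0_normc; apply/eqP; rewrite eq_le normc_ge0 andbT.
apply: le_trans (le_trans (maxN_ge _ j) max_le0).
by rewrite /abs_row_sum big_ord1 mxE.
Qed.

(** Both estimates of the norm of the inverse follow from this one by bounding
    numerator and denominator of the quotient separately. *)
Lemma norm_inf_invmx_nekrasov (R : realType) (n : nat) (A : 'M[R[i]]_n) :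
  (0 < n)%N -> nekrasov A ->
  exists k, norm_inf (invmx A) <= nek_z A k / (normc (A k k) - nek_h A k).
Proof.
move=> n_gt0 hA.
have [|k bound] := nekrasov_max_row_sum (B := invmx A) (M := 1) n_gt0 hA.
  move=> k; rewrite mulmxV ?nekrasov_unitmx // /abs_row_sum (bigD1 k) //= big1.
    by rewrite mxE eqxx ComplexField.Normc.normc1 addr0.
  by move=> j /negPf jk; rewrite mxE eq_sym jk ComplexField.Normc.normc0.
by exists k; rewrite ler_pdivlMr ?subr_gt0 // -[leRHS]mulr1.
Qed.

Theorem theorem2 (R : realType) (n : nat) (hn : (2 <= n)%N) (A : 'M[R[i]]_n)
    (hA : nekrasov A) :
  [/\ A \in unitmx,
      norm_inf (invmx A) <=
        maxN (fun i : 'I_n => nek_z A i / normc (A i i))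
        / (1 - maxN (fun i : 'I_n => nek_h A i / normc (A i i)))
    & norm_inf (invmx A) <=
        maxN (fun i : 'I_n => nek_z A i)
        / minN (fun i : 'I_n => normc (A i i) - nek_h A i)].
Proof.
have n_gt0 : (0 < n)%N by apply: leq_trans hn.
have [k bound] := norm_inf_invmx_nekrasov n_gt0 hA.
have ak_gt0 := nekrasov_diag_gt0 k hA.
have gap_gt0 : 0 < normc (A k k) - nek_h A k by rewrite subr_gt0.
split; first exact: nekrasov_unitmx; apply: le_trans bound _.
- set H := maxN (fun i => nek_h A i / _).
  have H_lt1 : 0 < 1 - H.
    rewrite /H; have [l ->] := maxN_attained (fun i => nek_h A i / normc (A i i)) n_gt0.
    by rewrite subr_gt0 ltr_pdivrMr ?mul1r ?(nekrasov_diag_gt0 l hA).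
  have scaledE : normc (A k k) - nek_h A k
      = normc (A k k) * (1 - nek_h A k / normc (A k k)).
    by rewrite mulrBr mulr1 mulrCA divff ?mulr1 // gt_eqF.
  have ratio_gt0 : 0 < 1 - nek_h A k / normc (A k k).
    by move: gap_gt0; rewrite scaledE pmulr_rgt0.
  rewrite scaledE invfM mulrA; apply: ler_pM.
  + by rewrite divr_ge0 ?nek_z_ge0 ?ltW.
  + by rewrite invr_ge0 ltW.
  + exact: (maxN_ge (fun i => nek_z A i / normc (A i i)) k).
  + rewrite lef_pV2 ?posrE // lerD2l lerN2.
    exact: (maxN_ge (fun i => nek_h A i / normc (A i i)) k).
- have min_gt0 : 0 < minN (fun i => normc (A i i) - nek_h A i).
    have [l ->] := minN_attained (fun i => normc (A i i) - nek_h A i) n_gt0.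
    by rewrite subr_gt0.
  apply: ler_pM; rewrite ?nek_z_ge0 ?invr_ge0 ?(ltW gap_gt0) //.
    exact: maxN_ge.
  rewrite lef_pV2 ?posrE //.
  exact: (minN_le (fun i => normc (A i i) - nek_h A i) k).
Qed.
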